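(* Let $\Delta\subset\mathbb{R}^2$ be a non-empty minimal lattice polygon with $\operatorname{lw}(\Delta)=d$. Then $\Delta$ is unimodularly equivalent to a minimal polygon of one of the following forms: (T1) $\operatorname{conv}\{(0,0),(d,y),(x,d)\}$ where $x,y\in\{0,\ldots,d\}$ satisfy $x+y\le d$; (T2) $\operatorname{conv}\{(x_1,0),(d,y_2),(x_2,d),(0,y_1)\}$ where $x_1,x_2,y_1,y_2\in\{1,\ldots,d-1\}$ satisfy $\max(x_2,y_2)\ge\min(x_1,y_1)$ and $\max(d-x_2,y_1)\ge\min(d-x_1,y_2)$; (T3) $\operatorname{conv}\{(0,0),(\ell,0),(d,y+d-\ell),(x+\ell,d),(z,z+d-\ell)\}$ with $\ell\in\{2,\ldots,d-2\}$, $x\in\{1,\ldots,d-\ell-1\}$, $y,z\in\{1,\ldots,\ell-1\}$; (T4) $\operatorname{conv}\{(0,0),(z'+\ell,z'),(d,y+d-\ell),(x+\ell,d),(z,z+d-\ell)\}$ with $\ell\in\{2,\ldots,d-2\}$, $y,z\in\{1,\ldots,\ell-1\}$, $x,z'\in\{1,\ldots,d-\ell-1\}$; (T5) $\operatorname{conv}\{(x_1,0),(z_2+\ell,z_2),(d,d-\ell+y_2),(x_2+\ell,d),(z_1,z_1+d-\ell),(0,y_1)\}$ with $\ell\in\{2,\ldots,d-2\}$, $x_1,y_2,z_1\in\{1,\ldots,\ell-1\}$, $x_2,y_1,z_2\in\{1,\ldots,d-\ell-1\}$.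
   Context: A lattice polygon is the convex hull of a finite non-empty set of points of $\mathbb{Z}^2$. For a lattice polygon $\Delta$ and a non-zero primitive $v\in\mathbb{Z}^2$, $\operatorname{lw}_v(\Delta)=\max_{Q\in\Delta}\langle Q,v\rangle-\min_{Q\in\Delta}\langle Q,v\rangle$, and the lattice width is $\operatorname{lw}(\Delta)=\min_v\operatorname{lw}_v(\Delta)$ over all non-zero primitive $v\in\mathbb{Z}^2$. A lattice polygon $\Delta$ is minimal if $\operatorname{lw}(\Delta')<\operatorname{lw}(\Delta)$ for every lattice polygon $\Delta'\subsetneq\Delta$. Two lattice polygons are (unimodularly) equivalent if one is the image of the other under a map $x\mapsto Ax+b$ with $A\in\mathrm{GL}_2(\mathbb{Z})$, $b\in\mathbb{Z}^2$. *)

(* Defs.v *)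
From HB Require Import structures.
From mathcomp Require Import all_boot all_order all_algebra.
Set Implicit Arguments. Unset Strict Implicit. Unset Printing Implicit Defensive.
Import Order.TTheory GRing.Theory Num.Theory.
Local Open Scope ring_scope.

Definition ipt := (int * int)%type.

Definition emb (R : realFieldType) (q : ipt) : R * R := (q.1%:~R, q.2%:~R).

Definition conv (R : realFieldType) (S : seq ipt) : R * R -> Prop :=
  fun p => exists w : 'I_(size S) -> R,
    (forall i, 0 <= w i) /\ \sum_(i < size S) w i = 1 /\
    p = (\sum_(i < size S) w i * (nth (0, 0) S i).1%:~R,
         \sum_(i < size S) w i * (nth (0, 0) S i).2%:~R).

Definition lattice_polygon (R : realFieldType) (P : R * R -> Prop) : Prop :=
  exists S : seq ipt, S <> [::] /\ forall p, P p <-> conv S p.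

Definition dotv (R : realFieldType) (p : R * R) (v : ipt) : R :=
  p.1 * v.1%:~R + p.2 * v.2%:~R.

Definition primitive (v : ipt) : Prop := gcdz v.1 v.2 = 1.

Definition lw_dir (R : realFieldType) (P : R * R -> Prop) (v : ipt) (w : R) : Prop :=
  exists a b : R,
    (exists Q, P Q /\ dotv Q v = a) /\ (forall Q, P Q -> dotv Q v <= a) /\
    (exists Q, P Q /\ dotv Q v = b) /\ (forall Q, P Q -> b <= dotv Q v) /\
    w = a - b.

Definition has_lw (R : realFieldType) (P : R * R -> Prop) (d : R) : Prop :=
  (exists v, primitive v /\ lw_dir P v d) /\
  (forall v w, primitive v -> lw_dir P v w -> d <= w).

Definition strict_subset (R : realFieldType) (P Q : R * R -> Prop) : Prop :=
  (forall p, P p -> Q p) /\ exists p, Q p /\ ~ P p.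

Definition minimal_polygon (R : realFieldType) (P : R * R -> Prop) : Prop :=
  lattice_polygon P /\
  forall P', lattice_polygon P' -> strict_subset P' P ->
    exists w w', has_lw P' w /\ has_lw P w' /\ w < w'.

Definition aff (R : realFieldType) (A : 'M[int]_2) (b : ipt) (p : R * R) : R * R :=
  ((A 0 0)%:~R * p.1 + (A 0 1)%:~R * p.2 + b.1%:~R,
   (A 1 0)%:~R * p.1 + (A 1 1)%:~R * p.2 + b.2%:~R).

Definition unimod_equiv (R : realFieldType) (P Q : R * R -> Prop) : Prop :=
  exists (A : 'M[int]_2) (b : ipt), `|\det A| = 1 /\
    forall q, Q q <-> exists p, P p /\ q = aff A b p.

Definition pt (a b : nat) : ipt := (Posz a, Posz b).

(* The five families (parameters are natural numbers; all coordinate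
   subtractions below are non-truncating under the stated ranges). *)
Definition family_T1 (d : nat) (S : seq ipt) : Prop :=
  exists x y : nat, (x <= d)%N /\ (y <= d)%N /\ (x + y <= d)%N /\
    S = [:: pt 0 0; pt d y; pt x d].

Definition family_T2 (d : nat) (S : seq ipt) : Prop :=
  exists x1 x2 y1 y2 : nat,
    (1 <= x1 <= d - 1)%N /\ (1 <= x2 <= d - 1)%N /\
    (1 <= y1 <= d - 1)%N /\ (1 <= y2 <= d - 1)%N /\
    (minn x1 y1 <= maxn x2 y2)%N /\
    (minn (d - x1) y2 <= maxn (d - x2) y1)%N /\
    S = [:: pt x1 0; pt d y2; pt x2 d; pt 0 y1].

Definition family_T3 (d : nat) (S : seq ipt) : Prop :=
  exists l x y z : nat,
    (2 <= l <= d - 2)%N /\ (1 <= x <= d - l - 1)%N /\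
    (1 <= y <= l - 1)%N /\ (1 <= z <= l - 1)%N /\
    S = [:: pt 0 0; pt l 0; pt d (y + d - l); pt (x + l) d; pt z (z + d - l)].

Definition family_T4 (d : nat) (S : seq ipt) : Prop :=
  exists l x y z z' : nat,
    (2 <= l <= d - 2)%N /\ (1 <= y <= l - 1)%N /\ (1 <= z <= l - 1)%N /\
    (1 <= x <= d - l - 1)%N /\ (1 <= z' <= d - l - 1)%N /\
    S = [:: pt 0 0; pt (z' + l) z'; pt d (y + d - l); pt (x + l) d;
            pt z (z + d - l)].

Definition family_T5 (d : nat) (S : seq ipt) : Prop :=
  exists l x1 y2 z1 x2 y1 z2 : nat,
    (2 <= l <= d - 2)%N /\
    (1 <= x1 <= l - 1)%N /\ (1 <= y2 <= l - 1)%N /\ (1 <= z1 <= l - 1)%N /\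
    (1 <= x2 <= d - l - 1)%N /\ (1 <= y1 <= d - l - 1)%N /\
    (1 <= z2 <= d - l - 1)%N /\
    S = [:: pt x1 0; pt (z2 + l) z2; pt d (d - l + y2); pt (x2 + l) d;
            pt z1 (z1 + d - l); pt 0 y1].

(* Main.v *)
Require Import Defs.
From HB Require Import structures.
From mathcomp Require Import all_boot all_order all_algebra.
From mathcomp Require Import zify ring.
From Stdlib Require Import Classical.
Set Implicit Arguments. Unset Strict Implicit. Unset Printing Implicit Defensive.
Import Order.TTheory GRing.Theory Num.Theory.
Local Open Scope ring_scope.

(** Minimality of [D] means that any finite set of lattice points of [D] whose
    width is at least [d] in every primitive direction spans [D].

    Take coordinates in which [D] has horizontal width [d]. If all directions
    [(k, 1)] had width greater than [d], then every direction [(a, b)], [b <> 0],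
    would have width at least [d + |b|]. Pushing the points of [D] that are highest
    above a chord [LR] joining the two vertical sides down by one then keeps all widths
    at least [d], so [D] must be closer than one to this chord; after a shear its
    height is less than [d], a contradiction. Hence [D] fits in the square
    [[0, d] x [0, d]] and touches its four sides.

    For points touching the four sides of the square, the width is automatically at
    least [d] in all directions except possibly [(1, 1)] and [(1, -1)], and these
    cannot both fail. If neither fails for some choice of four points, [D] is of type
    (T2), or (T1) when a corner is involved. Otherwise, up to reflection, [(1, -1)] fails,
    and minimality makes the width in that direction exactly [d]: then [D] touches the six
    sides of a hexagon [0 <= x, y <= d], [l - d <= x - y <= l], whose symmetries
    include a rotation of order six. If [D] contains two non-adjacent vertices of the
    hexagon, the square case applies in another basis; two adjacent
    vertices, one vertex or none give (T3), (T4) and (T5). *)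

(** * Unimodular maps and minimal sets of lattice points *)

Definition idot (q v : ipt) : int := q.1 * v.1 + q.2 * v.2.

(** Primitivity in a form that unimodular maps transport by pure algebra. *)
Definition bezout (v : ipt) : Prop := exists s t : int, s * v.1 + t * v.2 = 1.

Definition wide (d : int) (S : seq ipt) (v : ipt) : Prop :=
  exists p q, p \in S /\ q \in S /\ d <= idot p v - idot q v.

(** Affine maps with explicit integer entries, so that [ring] and [lia] apply after unfolding;
    [(me, mf)] is the translation. *)
Record amap := Amap { ma : int; mb : int; mc : int; md : int; me : int; mf : int }.

Definition ap (t : amap) (q : ipt) : ipt :=
  (ma t * q.1 + mb t * q.2 + me t, mc t * q.1 + md t * q.2 + mf t).

Definition mdet (t : amap) : int := ma t * md t - mb t * mc t.

Definition unim (t : amap) : Prop := mdet t * mdet t = 1.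

Definition acomp (t u : amap) : amap :=
  Amap (ma t * ma u + mb t * mc u) (ma t * mb u + mb t * md u)
       (mc t * ma u + md t * mc u) (mc t * mb u + md t * md u)
       (ma t * me u + mb t * mf u + me t) (mc t * me u + md t * mf u + mf t).

(** [D] times the adjugate, since [D] is its own inverse when [D * D = 1]. *)
Definition ainv (t : amap) : amap :=
  let D := mdet t in
  Amap (D * md t) (- D * mb t) (- D * mc t) (D * ma t)
       (D * (mb t * mf t - md t * me t)) (D * (mc t * me t - ma t * mf t)).

Definition tdir (t : amap) (v : ipt) : ipt :=
  (ma t * v.1 + mc t * v.2, mb t * v.1 + md t * v.2).

Lemma ap_comp t u q : ap (acomp t u) q = ap t (ap u q).
Proof. by rewrite /ap /=; congr pair; ring. Qed.

Lemma unim_comp t u : unim t -> unim u -> unim (acomp t u).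
Proof.
rewrite /unim => Ht Hu.
have -> : mdet (acomp t u) = mdet t * mdet u by rewrite /mdet /=; ring.
by rewrite mulrACA Ht Hu.
Qed.

Lemma unim_inv t : unim t -> unim (ainv t).
Proof.
rewrite /unim => H.
have -> : mdet (ainv t) = mdet t * mdet t * mdet t by rewrite {1}/mdet /= /mdet; ring.
by rewrite H mul1r.
Qed.

Definition aid : amap := Amap 1 0 0 1 0 0.

Lemma ap_id q : ap aid q = q.
Proof. by rewrite [RHS]surjective_pairing /ap /=; congr pair; ring. Qed.

Lemma acomp_inv t : unim t -> acomp t (ainv t) = aid.
Proof.
case: t => a b c e f g; rewrite /unim => H; rewrite /acomp /ainv /=.
set D := mdet _ in H *; have DE : D = a * e - b * c by [].
congr Amap; rewrite -?H; move: DE; clearbody D; move=> DE; [ | | | | | ]; try (rewrite DE; ring).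
  transitivity ((1 - D * D) * f); first by rewrite DE; ring.
  by rewrite H; ring.
transitivity ((1 - D * D) * g); first by rewrite DE; ring.
by rewrite H; ring.
Qed.

Lemma inv_acomp t : unim t -> acomp (ainv t) t = aid.
Proof.
case: t => a b c e f g; rewrite /unim => H; rewrite /acomp /ainv /=.
set D := mdet _ in H *; have DE : D = a * e - b * c by [].
by congr Amap; rewrite -?H; move: DE; clearbody D; move=> DE; rewrite DE; ring.
Qed.

Lemma ap_inv t q : unim t -> ap t (ap (ainv t) q) = q.
Proof. by move=> U; rewrite -ap_comp acomp_inv // ap_id. Qed.

Lemma inv_ap t q : unim t -> ap (ainv t) (ap t q) = q.
Proof. by move=> U; rewrite -ap_comp inv_acomp // ap_id. Qed.

Lemma idot_ap t p v : idot (ap t p) v = idot p (tdir t v) + idot (me t, mf t) v.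
Proof. by rewrite /idot /ap /tdir /=; ring. Qed.

Lemma idot_apB t p q v :
  idot (ap t p) v - idot (ap t q) v = idot p (tdir t v) - idot q (tdir t v).
Proof. by rewrite !idot_ap; ring. Qed.

Lemma tdir_bezout t v : unim t -> bezout v -> bezout (tdir t v).
Proof.
rewrite /unim => H [s [r E]].
  exists (mdet t * (md t * s - mb t * r)), (mdet t * (ma t * r - mc t * s)).
transitivity (mdet t * mdet t * (s * v.1 + r * v.2)); first by rewrite /mdet /=; ring.
by rewrite H E.
Qed.

Lemma wide_map t d S :
  unim t -> (forall v, bezout v -> wide d S v) ->
  forall v, bezout v -> wide d [seq ap t s | s <- S] v.
Proof.
move=> U W v /(tdir_bezout U) /W [p [q [Hp [Hq H]]]].
by exists (ap t p), (ap t q); rewrite !map_f // idot_apB.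
Qed.

(* [K] stands for the set of lattice points of a minimal polygon of width at least
   [d]. The conclusion of [minp_min] says, through support functions, that [S]
   spans the polygon. *)
Record minp (d : int) (K : ipt -> Prop) : Prop := Minp {
  minp_conv : forall (a b c : int) p q r s, 0 <= a -> 0 <= b -> 0 <= c ->
    0 < a + b + c ->
    (a + b + c) * s.1 = a * p.1 + b * q.1 + c * r.1 ->
    (a + b + c) * s.2 = a * p.2 + b * q.2 + c * r.2 ->
    K p -> K q -> K r -> K s;
  minp_gen : exists S : seq ipt, (forall s, s \in S -> K s) /\
    forall v q, K q -> exists s, s \in S /\ idot q v <= idot s v;
  minp_nonempty : exists q, K q;
  minp_width : forall v, bezout v ->
    exists p q, K p /\ K q /\ d <= idot p v - idot q v;
  minp_min : forall S, (forall s, s \in S -> K s) ->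
    (forall v, bezout v -> wide d S v) ->
    forall v q, K q -> exists s, s \in S /\ idot q v <= idot s v }.

Lemma minp_ap d K t : unim t -> minp d K -> minp d (fun q => K (ap t q)).
Proof.
move=> U M; have U' := unim_inv U; split.
- move=> a b c p q r s a0 b0 c0 abc E1 E2.
  apply: (minp_conv M (a := a) (b := b) (c := c)) => //; rewrite /ap /=.
    transitivity (ma t * ((a + b + c) * s.1) + mb t * ((a + b + c) * s.2) + (a + b + c) * me t).
      by ring.
    by rewrite E1 E2; ring.
  transitivity (mc t * ((a + b + c) * s.1) + md t * ((a + b + c) * s.2) + (a + b + c) * mf t).
    by ring.
  by rewrite E1 E2; ring.
- have [S [SK Sv]] := minp_gen M.
  exists [seq ap (ainv t) s | s <- S]; split.
    by move=> s /mapP [s' /SK s'K ->]; rewrite ap_inv.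
  move=> v q /(Sv (tdir (ainv t) v)) [s [sS H]].
  exists (ap (ainv t) s); split; first exact: map_f.
  by rewrite -(inv_ap q U) !(idot_ap (ainv t)) lerD2r.
- by have [q Kq] := minp_nonempty M; exists (ap (ainv t) q); rewrite ap_inv.
- move=> v /(tdir_bezout U') /(minp_width M) [p [q [Kp [Kq H]]]].
  exists (ap (ainv t) p), (ap (ainv t) q).
  by rewrite !ap_inv // idot_apB.
- move=> S SK W v q Kq.
  have [|s [sS H]] := minp_min M _ (wide_map U W) (tdir (ainv t) v) Kq.
    by move=> s /mapP [s' /SK s'K ->].
  case/mapP: sS => s' s'S Es; exists s'; split=> //.
  by rewrite -(inv_ap q U) -(inv_ap s' U) !(idot_ap (ainv t)) lerD2r -Es.
Qed.

Definition in_family (d : nat) (S : seq ipt) : Prop :=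
  family_T1 d S \/ family_T2 d S \/ family_T3 d S \/ family_T4 d S \/ family_T5 d S.

(** The goal for lattice points: a family member maps into [K] and has width at least [d] in every
    primitive direction; minimality then makes its image span the polygon. *)
Definition good (d : nat) (K : ipt -> Prop) : Prop :=
  exists t S, unim t /\ in_family d S /\ (forall s, s \in S -> K (ap t s)) /\
    forall v, bezout v -> wide d S v.

Lemma good_ap d K t : unim t -> good d (fun q => K (ap t q)) -> good d K.
Proof.
move=> U [u [S [Uu [F [SK W]]]]]; exists (acomp t u), S; split; first exact: unim_comp.
by split=> //; split=> // s /SK; rewrite ap_comp.
Qed.

Lemma seq_max (T : eqType) (f : T -> int) (S : seq T) x :
  x \in S -> exists s, s \in S /\ forall y, y \in S -> f y <= f s.
Proof.
elim: S x => // a S IH x _; case: S IH => [|b S] IH.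
  by exists a; split=> [|y]; rewrite ?mem_head // inE => /eqP ->.
have [s [sS H]] := IH b (mem_head _ _).
case: (lerP (f a) (f s)) => Has.
  exists s; split; first by rewrite inE sS orbT.
  by move=> y; rewrite inE => /orP [/eqP -> //|/H].
exists a; split; first exact: mem_head.
by move=> y; rewrite inE => /orP [/eqP -> //|/H]; lia.
Qed.

Lemma minp_max d K v : minp d K -> exists q, K q /\ forall p, K p -> idot p v <= idot q v.
Proof.
move=> M; have [S [SK Sv]] := minp_gen M; have [q /(Sv v) [s [sS _]]] := minp_nonempty M.
have [m [mS Hm]] := seq_max (idot^~ v) sS.
exists m; split; first exact: SK.
by move=> p /(Sv v) [r [/Hm rS H]]; lia.
Qed.

Lemma minp_width1 d K v : minp d K -> v.1 = 1 \/ v.2 = 1 ->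
  exists p q, K p /\ K q /\ d <= idot p v - idot q v.
Proof.
move=> M H; apply: (minp_width M).
case: H => H; [exists 1, 0 | exists 0, 1]; rewrite H; ring.
Qed.

(** * A second width direction *)

Definition xwidth_le (d : int) (K : ipt -> Prop) := forall p q, K p -> K q -> p.1 - q.1 <= d.

(* Compare with the direction [(k, 1)] for which [|a - k b| <= b / 2]. *)
Lemma width_off_axis (d : int) K (a b : int) : 0 <= d -> minp d K -> xwidth_le d K ->
  (forall k, exists p q, K p /\ K q /\ d + 1 <= idot p (k, 1) - idot q (k, 1)) ->
  b != 0 -> exists p q, K p /\ K q /\ d + `|b| <= idot p (a, b) - idot q (a, b).
Proof.
move=> d0 M X W.
have pos a' b' : 0 < b' -> exists p q, K p /\ K q /\ d + b' <= idot p (a', b') - idot q (a', b').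
  (* [k] is the integer nearest to [a' / b']. *)
  move=> b0; pose k := ((2 * a' + b') %/ (2 * b'))%Z.
  have b20 : 2 * b' != 0 by lia.
  have Ek := divz_eq (2 * a' + b') (2 * b').
  have := modz_ge0 (2 * a' + b') b20; have := ltz_pmod (2 * a' + b') (d := 2 * b').
  rewrite -/k in Ek; set m := modz _ _ in Ek *; move=> mlt m0.
  have {}mlt : m < 2 * b' by apply: mlt; lia.
  have [p [q [Kp [Kq H]]]] := W k; exists p, q; split=> //; split=> //.
  have X1 := X _ _ Kp Kq; have X2 := X _ _ Kq Kp.
  move: H; rewrite /idot /=; set c := a' - k * b'.
  set u := p.1 - q.1; set w := p.2 - q.2 => H.
  (* Write [(a', b')] as [b'] times [(k, 1)] plus [(c, 0)]. The first part contributes at least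
     [b' (d + 1)] and the second costs at most [b' d / 2], which suffices for [b' >= 2]; for
     [b' = 1], [c = 0]. *)
  have -> : p.1 * a' + p.2 * b' - (q.1 * a' + q.2 * b') = b' * (k * u + w) + c * u.
    by rewrite /u /w /c; ring.
  have {}H : d + 1 <= k * u + w by rewrite /u /w; lia.
  have hu : - d <= u <= d by rewrite /u; lia.
  have hc : - b' <= 2 * c <= b' by rewrite /c; lia.
  have H1 : b' * (d + 1) <= b' * (k * u + w) by rewrite ler_pM2l.
  have [b1|b2] : b' = 1 \/ 2 <= b' by lia.
    have c0 : c = 0 by lia.
    by rewrite c0; lia.
  have H2 : - (b' * d) <= 2 * (c * u) by nia.
  have H3 : 2 * d <= b' * d by rewrite ler_wpM2r.
  by lia.
move=> b0; have [bp|bn] : 0 < b \/ 0 < - b by lia.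
  by rewrite gtr0_norm //; apply: pos.
have [p [q [Kp [Kq H]]]] := pos (- a) (- b) bn; exists q, p; split=> //; split=> //.
by move: H; rewrite -normrN gtr0_norm // /idot /=; lia.
Qed.

(* A point at vertical distance at least 1 above the chord [LR] can be pushed
   down by one inside [K]; pushing down all the points farthest above the chord
   lowers the width in direction [(a, b)] by at most [|b|]. *)
Lemma below_chord (d : int) K L R : 0 < d -> minp d K -> xwidth_le d K ->
  (forall k, exists p q, K p /\ K q /\ d + 1 <= idot p (k, 1) - idot q (k, 1)) ->
  K L -> K R -> R.1 = L.1 + d ->
  forall q, K q -> d * (q.2 - L.2) - (q.1 - L.1) * (R.2 - L.2) < d.
Proof.
move=> d0 M X W KL KR ER q Kq.
(* [v] is normal to the chord, and [idot p v + c] is [d] times the vertical height of [p] above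
   it. *)
pose v : ipt := (- (R.2 - L.2), d); pose c := L.1 * (R.2 - L.2) - d * L.2.
have fE p : d * (p.2 - L.2) - (p.1 - L.1) * (R.2 - L.2) = idot p v + c.
  by rewrite /idot /v /c /=; ring.
rewrite fE ltNge; apply/negP => fq.
have [S [SK Sv]] := minp_gen M.
have [s [sS fs]] := Sv v q Kq.
have [m [mS mmax]] := seq_max (idot^~ v) sS.
pose phi (p : ipt) : ipt := if idot p v == idot m v then (p.1, p.2 - 1) else p.
have phi1 p : (phi p).1 = p.1 by rewrite /phi; case: ifP.
have phi2 p : (phi p).2 = p.2 - 1 \/ (phi p).2 = p.2 by rewrite /phi; case: ifP; [left|right].
have phiK p : p \in [seq phi s | s <- S] -> K p.
  case/mapP=> {}p /[dup] pS /SK Kp ->; rewrite /phi; case: eqP => // Epm.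
  have fp : d <= idot p v + c by have := mmax _ sS; lia.
  have XL := X _ _ KR Kp; have XR := X _ _ Kp KL.
  (* The lowered point is a barycentre of [p], [L], [R]; the first weight is nonnegative because the
     height is at least one. *)
  apply: (minp_conv M (a := idot p v + c - d) (b := L.1 + d - p.1) (c := p.1 - L.1)
    (p := p) (q := L) (r := R)) => //=; [lia|lia|lia|lia| |].
    by rewrite ER; ring.
  by rewrite -fE; ring.
have SW w : bezout w -> wide d [seq phi s | s <- S] w.
  (* Lowering costs at most [|w.2|] in direction [w], which the slack from [width_off_axis]
     covers. *)
  move=> Bw; have [p [r [Kp [Kr H]]]] : exists p r, K p /\ K r /\ d + `|w.2| <= idot p w - idot r w.
    have [w0|w0] := eqVneq w.2 0.
      by have [p [r H]] := minp_width M Bw; exists p, r; rewrite w0 normr0 addr0.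
    have [|p [r H]] := width_off_axis w.1 _ M X W w0; first lia.
    by exists p, r; rewrite [w]surjective_pairing.
  have [p' [p'S Hp]] := Sv w p Kp.
  have [r' [r'S Hr]] := Sv (- w.1, - w.2) r Kr.
  exists (phi p'), (phi r'); rewrite !map_f //; split=> //; split=> //.
  move: H Hp Hr; rewrite /idot /= !phi1.
  have := ler_norm w.2; have := ler_norm (- w.2); rewrite normrN; set n := `|w.2|.
  by case: (phi2 p') => ->; case: (phi2 r') => ->; lia.
(* All pushed generators are strictly below the old maximum of [v], so they cannot span. *)
have [p [pS]] := minp_min M phiK SW v (SK _ mS).
case/mapP: pS => r rS ->; have Hr := mmax _ rS; rewrite /phi; case: eqP => [Er|]; last by lia.
by move: Er; rewrite {1 3}/idot /=; rewrite /idot /=; lia.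
Qed.

Lemma second_direction (d : int) K : 0 <= d -> minp d K -> xwidth_le d K ->
  exists k, forall p q, K p -> K q -> idot p (k, 1) - idot q (k, 1) <= d.
Proof.
move=> d0 M X; apply: NNPP => H.
have W k : exists p q, K p /\ K q /\ d + 1 <= idot p (k, 1) - idot q (k, 1).
  apply: NNPP => Hk; apply: H; exists k => p q Kp Kq.
  by rewrite leNgt; apply/negP => Hl; apply: Hk; exists p, q; split=> //; split=> //; lia.
(* For [d = 0] a single point has width [d] in all directions, hence spans, against a vertical width
   of at least one. *)
have [E0|{}d0] : d = 0 \/ 0 < d by lia.
  have [q0 Kq0] := minp_nonempty M.
  have [p [q [Kp [Kq]]]] := W 0.
  have sub (S : seq ipt) : S = [:: q0] -> forall v p, K p -> idot p v <= idot q0 v.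
    move=> ES v r Kr; have [||s [sS]] := minp_min M (S := S) _ _ v Kr.
    - by rewrite ES => s; rewrite inE => /eqP ->.
    - by move=> w _; exists q0, q0; rewrite ES !mem_head E0 subrr.
    by move: sS; rewrite ES inE => /eqP ->.
  have := sub _ erefl (0, 1) p Kp; have := sub _ erefl (0, -1) q Kq.
  by rewrite /idot /=; lia.
have [R [L [KR [KL]]]] : exists p q, K p /\ K q /\ d <= idot p (1, 0) - idot q (1, 0).
  by apply: (minp_width1 M); left.
rewrite /idot /= => HRL; have ER : R.1 = L.1 + d by have := X _ _ KR KL; lia.
have up := below_chord d0 M X W KL KR ER.
have down q : K q -> - d < d * (q.2 - L.2) - (q.1 - L.1) * (R.2 - L.2).
  pose t := Amap 1 0 0 (-1) 0 0.
  have U : unim t by [].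
  have Mt := minp_ap U M.
  have tt p : ap t (p.1, - p.2) = p by rewrite [RHS]surjective_pairing /ap /=; congr pair; ring.
  have X' : xwidth_le d (fun q => K (ap t q)).
    by move=> p r Kp Kr; have := X _ _ Kp Kr; rewrite /ap /=; lia.
  have W' k : exists p q, K (ap t p) /\ K (ap t q) /\ d + 1 <= idot p (k, 1) - idot q (k, 1).
    have [p [r [Kp [Kr]]]] := W (- k); exists (r.1, - r.2), (p.1, - p.2).
    by rewrite !tt; split=> //; split=> //; move: b; rewrite /idot /=; lia.
  have KL' : K (ap t (L.1, - L.2)) by rewrite tt.
  have KR' : K (ap t (R.1, - R.2)) by rewrite tt.
  move=> Kq; have Kq' : K (ap t (q.1, - q.2)) by rewrite tt.
  by have /= := below_chord d0 Mt X' W' KL' KR' ER Kq'; lia.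
(* The shear by [k] reduces the rise of the chord from [L] to [R] to the remainder [r < d]. *)
pose k : int := - ((R.2 - L.2) %/ d)%Z.
have Ek := divz_eq (R.2 - L.2) d.
have r0 := modz_ge0 (R.2 - L.2) (lt0r_neq0 d0).
have rd := ltz_pmod (R.2 - L.2) d0.
set r := modz _ _ in Ek r0 rd.
have {}Ek : R.2 - L.2 = r - k * d by rewrite /k; lia.
(* Within less than one of a chord rising from 0 to [r], integral heights stay between 0 and [r]. *)
have rng q : K q -> 0 <= idot q (k, 1) - idot L (k, 1) <= r.
  move=> Kq; have := up q Kq; have := down q Kq; rewrite Ek.
  have XL := X _ _ KR Kq; have XR := X _ _ Kq KL.
  rewrite /idot /=; set x := q.1 - L.1 in XR *; set y := q.2 - L.2.
  have -> : q.1 * k + q.2 * 1 - (L.1 * k + L.2 * 1) = k * x + y by rewrite /x /y; ring.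
  have -> : d * y - x * (r - k * d) = d * (k * x + y) - x * r by ring.
  have xd : 0 <= x <= d by rewrite /x; lia.
  set g := k * x + y => H1 H2.
  have xr : 0 <= x * r <= d * r by nia.
  have : - d < d * g by lia.
  have : d * g < d * (r + 1) by lia.
  rewrite ltr_pM2l // => g1 g2.
  have : d * (-1) < d * g by lia.
  by rewrite ltr_pM2l //; lia.
have [p [q [Kp [Kq Hpq]]]] := W k.
have := rng p Kp; have := rng q Kq; move: Hpq.
set u := idot p _; set w := idot q _; set z := idot L _; clearbody u w z r.
by lia.
Qed.

(** * Polygons in a square *)

Definition in_square (d : int) (K : ipt -> Prop) : Prop :=
  forall q, K q -> (0 <= q.1 <= d) && (0 <= q.2 <= d).

Definition touch (d : int) (K : ipt -> Prop) (x1 y2 x2 y1 : int) : Prop :=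
  [/\ K (x1, 0), K (d, y2), K (x2, d) & K (0, y1)].

(** Each disjunct says that [x + y] at the top or right point exceeds its value at the bottom or
    left point by at least [d]; together they are the first inequality of (T2). *)
Definition diag_ok (x1 y2 x2 y1 : int) : bool :=
  [|| x1 <= x2, y1 <= x2, x1 <= y2 | y1 <= y2].

(** The analogue for [x - y], comparing the bottom or right point with the top or left one: the
    second inequality of (T2). *)
Definition antidiag_ok (d x1 y2 x2 y1 : int) : bool :=
  [|| x2 <= x1, d - x1 <= y1, y2 <= d - x2 | y2 <= y1].

Lemma touch_bounds (d : int) K (x1 y2 x2 y1 : int) : in_square d K -> touch d K x1 y2 x2 y1 ->
  [&& 0 <= x1 <= d, 0 <= y2 <= d, 0 <= x2 <= d & 0 <= y1 <= d].
Proof. by move=> H [/H /= + /H /= + /H /= + /H /=]; lia. Qed.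

(** For integers [|b| <= a - 1], so the second term removes at most [d (a - 1)] from [d a]. *)
Lemma steep_width (d u a b : int) :
  0 <= d -> - d <= u <= d -> b < a -> - b < a -> d <= d * a + u * b.
Proof.
move=> d0 ud ba nba; have [b0|b0] := lerP 0 b.
  have : 0 <= (d + u) * b by apply: mulr_ge0; lia.
  have : 0 <= d * (a - b - 1) by apply: mulr_ge0; lia.
  by lia.
have : 0 <= (d - u) * (- b) by apply: mulr_ge0; lia.
have : 0 <= d * (a + b - 1) by apply: mulr_ge0; lia.
by lia.
Qed.

(* Width in a direction [(a, b)] with [|a| != |b|] is automatic. *)
Lemma square_wide (d : int) (S : seq ipt) (x1 y2 x2 y1 : int) : 0 <= d ->
  [&& 0 <= x1 <= d, 0 <= y2 <= d, 0 <= x2 <= d & 0 <= y1 <= d] ->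
  touch d (fun q => q \in S) x1 y2 x2 y1 -> wide d S (1, 1) -> wide d S (1, -1) ->
  forall v, bezout v -> wide d S v.
Proof.
move=> d0 /and4P [bx1 by2 bx2 by1] [S1 S2 S3 S4] W1 W2 [a b] [s [t /= E]].
have diag (e n : int) : n != 0 -> wide d S (1, e) -> wide d S (n, n * e).
  move=> n0 [p [q [Sp [Sq H]]]]; have [np|nn] : 0 < n \/ 0 < - n by lia.
    exists p, q; split=> //; split=> //.
    have -> : idot p (n, n * e) - idot q (n, n * e) = n * (idot p (1, e) - idot q (1, e)).
      by rewrite /idot /=; ring.
    by nia.
  exists q, p; split=> //; split=> //.
  have -> : idot q (n, n * e) - idot p (n, n * e) = (- n) * (idot p (1, e) - idot q (1, e)).
    by rewrite /idot /=; ring.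
  by nia.
(* The lines [a = b] and [a = - b] cut the directions into four open cones; in each, two points on
   opposite sides of the square give the width. *)
have : [\/ a = b, a = - b, b < a /\ - b < a |
  [\/ b < - a /\ - b < - a, a < b /\ - a < b | a < - b /\ - a < - b]].
  have [?|?] := eqVneq a b; first by constructor 1.
  have [?|?] := eqVneq a (- b); first by constructor 2.
  have [?|?] := boolP ((b < a) && (- b < a)); first by constructor 3; lia.
  constructor 4.
  have [?|?] := boolP ((b < - a) && (- b < - a)); first by constructor 1; lia.
  have [?|?] := boolP ((a < b) && (- a < b)); first by constructor 2; lia.
  by constructor 3; lia.
case=> [Eab|Eab|[h1 h2]|[[h1 h2]|[h1 h2]|[h1 h2]]].
- have a0 : a != 0 by apply/eqP => a0; move: E; rewrite -Eab a0; lia.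
  by have := diag 1 a a0 W1; rewrite mulr1 {2}Eab.
- have a0 : a != 0 by apply/eqP => a0; move: E; rewrite (_ : b = 0) ?a0; lia.
  have := diag (-1) a a0 W2; rewrite (_ : a * -1 = b) //; lia.
- exists (d, y2), (0, y1); split=> //; split=> //; rewrite /idot /=.
  have : d <= d * a + (y2 - y1) * b by apply: steep_width => //; lia.
  by lia.
- exists (0, y1), (d, y2); split=> //; split=> //; rewrite /idot /=.
  have : d <= d * (- a) + (y1 - y2) * b by apply: steep_width => //; lia.
  by lia.
- exists (x2, d), (x1, 0); split=> //; split=> //; rewrite /idot /=.
  have : d <= d * b + (x2 - x1) * a by apply: steep_width => //; lia.
  by lia.
- exists (x1, 0), (x2, d); split=> //; split=> //; rewrite /idot /=.
  have : d <= d * (- b) + (x1 - x2) * a by apply: steep_width => //; lia.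
  by lia.
Qed.

Lemma diag_wide (d : int) (S : seq ipt) x1 y2 x2 y1 :
  touch d (fun q => q \in S) x1 y2 x2 y1 -> diag_ok x1 y2 x2 y1 -> wide d S (1, 1).
Proof.
case=> S1 S2 S3 S4; rewrite /diag_ok => /or4P [] H.
- by exists (x2, d), (x1, 0); split=> //; split=> //; rewrite /idot /=; lia.
- by exists (x2, d), (0, y1); split=> //; split=> //; rewrite /idot /=; lia.
- by exists (d, y2), (x1, 0); split=> //; split=> //; rewrite /idot /=; lia.
- by exists (d, y2), (0, y1); split=> //; split=> //; rewrite /idot /=; lia.
Qed.

Lemma antidiag_wide (d : int) (S : seq ipt) x1 y2 x2 y1 :
  touch d (fun q => q \in S) x1 y2 x2 y1 -> antidiag_ok d x1 y2 x2 y1 -> wide d S (1, -1).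
Proof.
case=> S1 S2 S3 S4; rewrite /antidiag_ok => /or4P [] H.
- by exists (x1, 0), (x2, d); split=> //; split=> //; rewrite /idot /=; lia.
- by exists (x1, 0), (0, y1); split=> //; split=> //; rewrite /idot /=; lia.
- by exists (d, y2), (x2, d); split=> //; split=> //; rewrite /idot /=; lia.
- by exists (d, y2), (0, y1); split=> //; split=> //; rewrite /idot /=; lia.
Qed.

Lemma T1_int (d : nat) (x y : int) : 0 <= x -> 0 <= y -> x + y <= d ->
  in_family d [:: (0, 0); (d : int, y); (x, d : int)].
Proof.
case: x => // x _; case: y => // y _ H; left; exists x, y.
by do ![split=> //]; lia.
Qed.

Lemma T2_int (d : nat) (x1 y2 x2 y1 : int) :
  [&& 0 < x1 < d, 0 < y2 < d, 0 < x2 < d & 0 < y1 < d] ->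
  diag_ok x1 y2 x2 y1 -> antidiag_ok d x1 y2 x2 y1 ->
  in_family d [:: (x1, 0); (d : int, y2); (x2, d : int); (0, y1)].
Proof.
rewrite /diag_ok /antidiag_ok.
case: x1 => [x1|x1]; case: x2 => [x2|x2]; case: y1 => [y1|y1]; case: y2 => [y2|y2]; try lia.
move=> B D1 D2; right; left; exists x1, x2, y1, y2.
by do ![split; first by lia].
Qed.

Lemma good_id (d : nat) (K : ipt -> Prop) S : in_family d S ->
  (forall s, s \in S -> K s) -> (forall v, bezout v -> wide d S v) -> good d K.
Proof.
move=> F SK W; exists aid, S; do ![split=> //].
by move=> s /SK; rewrite ap_id.
Qed.

(** If [x + y <= d], the corner and the points on the far sides form a (T1) triangle. Otherwise the
    left side also contains [(0, y)], which leads to (T1) again for [y = d] and to (T2) in other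
    coordinates for [y < d]. *)
Lemma corner_good (d : nat) K (x y y1 : int) : minp d K -> in_square d K ->
  K (0, 0) -> K (0, y1) -> K (d : int, y) -> K (x, d : int) ->
  (x + y <= d) || (y <= y1) -> good d K.
Proof.
move=> M Q K0 Kl Kr Kt H.
have /= Bl := Q _ Kl; have /= Br := Q _ Kr; have /= Bt := Q _ Kt.
have T1 x' y' : K (d : int, y') -> K (x', d : int) ->
    0 <= x' -> 0 <= y' -> x' + y' <= d -> good d K.
  move=> Kr' Kt' x0 y0 xy; apply: (good_id (T1_int x0 y0 xy)).
    by move=> s; rewrite !inE => /or3P [] /eqP ->.
  have tS : touch d (fun q => q \in [:: (0, 0); (d : int, y'); (x', d : int)]) 0 y' x' 0.
    by split; rewrite !inE eqxx ?orbT.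
  apply: (square_wide _ _ tS); [lia|lia| |].
    by apply: (diag_wide tS); rewrite /diag_ok; lia.
  by apply: (antidiag_wide tS); rewrite /antidiag_ok; lia.
have [xy|xy] := lerP (x + y) d; first by apply: (T1 x y) => //; lia.
have {}H : y <= y1 by lia.
have Ky : K (0, y).
  have [y10|y10] : y1 = 0 \/ 0 < y1 by lia.
    by rewrite (_ : y = 0) //; lia.
  by apply: (minp_conv M (a := y1 - y) (b := y) (c := 0) _ _ _ _ _ _ K0 Kl K0) => /=; lia.
have [Ey|yd] : y = d \/ y < d by lia.
  by rewrite Ey in Kr Ky; apply: (T1 0 d) => //; lia.
(* The inverse of [t] sends [(0, y)], [(x, d)], [(d, y)], [(0, 0)] to interior points of the bottom,
   right, top and left sides of the square. *)
pose t := Amap 1 1 1 0 (- y) 0.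
apply: (good_ap (t := t)) => //.
have D1 : diag_ok y (x - d%:Z + y) y y by rewrite /diag_ok; lia.
have D2 : antidiag_ok d y (x - d%:Z + y) y y by rewrite /antidiag_ok; lia.
have F : in_family d [:: (y, 0); (d : int, x - d%:Z + y); (y, d : int); (0, y)].
  by apply: T2_int => //; lia.
apply: (good_id F).
  move=> s; rewrite !inE => /or4P [] /eqP ->; rewrite /ap /=.
  - by rewrite (_ : (_, _) = (0, y)) //; congr pair; ring.
  - by rewrite (_ : (_, _) = (x, d : int)) //; congr pair; ring.
  - by rewrite (_ : (_, _) = (d : int, y)) //; congr pair; ring.
  - by rewrite (_ : (_, _) = (0, 0)) //; congr pair; ring.
have tS : touch d (fun q => q \in [:: (y, 0); (d : int, x - d%:Z + y); (y, d : int); (0, y)])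
    y (x - d%:Z + y) y y.
  by split; rewrite !inE eqxx ?orbT.
apply: (square_wide _ _ tS); [lia|lia| |].
  exact: (diag_wide tS).
exact: (antidiag_wide tS).
Qed.

Lemma square_ap (d : int) K t : in_square d K ->
  (forall q, (0 <= (ap t q).1 <= d) && (0 <= (ap t q).2 <= d) ->
             (0 <= q.1 <= d) && (0 <= q.2 <= d)) ->
  in_square d (fun q => K (ap t q)).
Proof. by move=> Q H q /Q /H. Qed.

(** A quarter turn of the square. Like the reflection [refl4], it exchanges the directions [(1, 1)]
    and [(1, -1)] up to sign, hence [diag_ok] and [antidiag_ok]. *)
Definition rot4 (d : int) := Amap 0 1 (-1) 0 0 d.
Definition refl4 (d : int) := Amap (-1) 0 0 1 d 0.

Lemma rot4_touch (d : int) K (x1 y2 x2 y1 : int) : touch d K x1 y2 x2 y1 ->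
  touch d (fun q => K (ap (rot4 d) q)) (d - y1) x1 (d - y2) x2.
Proof.
rewrite /touch /ap /=; case=> K1 K2 K3 K4; split.
- by rewrite (_ : (_, _) = (0, y1)) //; congr pair; ring.
- by rewrite (_ : (_, _) = (x1, 0)) //; congr pair; ring.
- by rewrite (_ : (_, _) = (d, y2)) //; congr pair; ring.
- by rewrite (_ : (_, _) = (x2, d)) //; congr pair; ring.
Qed.

Lemma refl4_touch (d : int) K (x1 y2 x2 y1 : int) : touch d K x1 y2 x2 y1 ->
  touch d (fun q => K (ap (refl4 d) q)) (d - x1) y1 (d - x2) y2.
Proof.
rewrite /touch /ap /=; case=> K1 K2 K3 K4; split.
- by rewrite (_ : (_, _) = (x1, 0)) //; congr pair; ring.
- by rewrite (_ : (_, _) = (0, y1)) //; congr pair; ring.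
- by rewrite (_ : (_, _) = (x2, d)) //; congr pair; ring.
- by rewrite (_ : (_, _) = (d, y2)) //; congr pair; ring.
Qed.

(** Without corners among the touching points this is (T2). A corner among them is brought to the
    origin by quarter turns, after a reflection if needed, and [corner_good] applies. *)
Lemma square_good (d : nat) K (x1 y2 x2 y1 : int) : minp d K -> in_square d K ->
  touch d K x1 y2 x2 y1 -> diag_ok x1 y2 x2 y1 -> antidiag_ok d x1 y2 x2 y1 ->
  good d K.
Proof.
have bottom_left K' a1 b2 a2 b1 : minp d K' -> in_square d K' ->
    touch d K' a1 b2 a2 b1 -> antidiag_ok d a1 b2 a2 b1 -> a1 = 0 -> good d K'.
  move=> M Q T D E; have := touch_bounds Q T.
  case: T => K1 K2 K3 K4; rewrite E in K1 => B.
  by apply: (corner_good M Q K1 K4 K2 K3); move: D; rewrite /antidiag_ok E; lia.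
(* The list holds the bottom coordinate after 0, 1, 2, 3 quarter turns; the default 1 excludes
   larger [n]. *)
have rot n K' a1 b2 a2 b1 : minp d K' -> in_square d K' ->
    touch d K' a1 b2 a2 b1 -> diag_ok a1 b2 a2 b1 -> antidiag_ok d a1 b2 a2 b1 ->
    nth 1 [:: a1; d%:Z - b1; d%:Z - a2; b2] n = 0 -> good d K'.
  elim: n K' a1 b2 a2 b1 => [|n IH] K' a1 b2 a2 b1 M Q T D1 D2 E.
    exact: (bottom_left K' a1 b2 a2 b1).
  apply: (good_ap (t := rot4 d)) => //.
  apply: (IH _ (d%:Z - b1) a1 (d%:Z - b2) a2).
  - exact: minp_ap.
  - by apply: square_ap => // q; rewrite /ap /=; lia.
  - exact: rot4_touch.
  - by move: D2; rewrite /diag_ok /antidiag_ok; lia.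
  - by move: D1; rewrite /diag_ok /antidiag_ok; lia.
  - by move: E; case: n {IH} => [|[|[|n]]] //=; rewrite ?nth_nil //; lia.
move=> M Q T D1 D2; have B := touch_bounds Q T.
have [|N1] := boolP [|| x1 == 0, d%:Z - y1 == 0, d%:Z - x2 == 0 | y2 == 0].
  case/or4P => /eqP E.
  - exact: (rot 0 K x1 y2 x2 y1).
  - exact: (rot 1 K x1 y2 x2 y1).
  - exact: (rot 2 K x1 y2 x2 y1).
  - exact: (rot 3 K x1 y2 x2 y1).
have [E|N2] := boolP [|| d%:Z - x1 == 0, d%:Z - y2 == 0, x2 == 0 | y1 == 0].
  apply: (good_ap (t := refl4 d)) => //.
  have Mr : minp d (fun q => K (ap (refl4 d) q)) by apply: minp_ap.
  have Qr : in_square d (fun q => K (ap (refl4 d) q)).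
    by apply: square_ap => // q; rewrite /ap /=; lia.
  have D1' : diag_ok (d%:Z - x1) y1 (d%:Z - x2) y2.
    by move: D2; rewrite /diag_ok /antidiag_ok; lia.
  have D2' : antidiag_ok d (d%:Z - x1) y1 (d%:Z - x2) y2.
    by move: D1; rewrite /diag_ok /antidiag_ok; lia.
  have rot' n := rot n _ _ _ _ _ Mr Qr (refl4_touch T) D1' D2'.
  case/or4P: E => /eqP E;
    [apply: (rot' 0)|apply: (rot' 1)|apply: (rot' 2)|apply: (rot' 3)] => /=; lia.
have F : in_family d [:: (x1, 0); (d : int, y2); (x2, d : int); (0, y1)].
  by apply: T2_int => //; lia.
have tS : touch d (fun q => q \in [:: (x1, 0); (d : int, y2); (x2, d : int); (0, y1)]) x1 y2 x2 y1.
  by split; rewrite !inE eqxx ?orbT.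
apply: (good_id F).
  by case: T => ? ? ? ? s; rewrite !inE => /or4P [] /eqP ->.
apply: (square_wide _ _ tS) => //.
  exact: (diag_wide tS).
exact: (antidiag_wide tS).
Qed.

(** * Polygons in a hexagon *)

Record hex (d : nat) (l : int) (K : ipt -> Prop) : Prop := Hex {
  hex_minp : minp d K;
  hex_param : 0 <= l <= d;
  hex_square : in_square d K;
  hex_strip : forall q, K q -> l - d%:Z <= q.1 - q.2 <= l }.

(* The vertices of the hexagon, counterclockwise and indexed modulo 6. *)
Definition hex_vertex (d : nat) (l : int) (i : nat) : ipt :=
  nth (0, 0) [:: (0, 0); (l, 0); (d%:Z, d%:Z - l); (d%:Z, d%:Z); (l, d%:Z); (0, d%:Z - l)]
      (i %% 6).

(** Points are given by coordinates here, while the family uses the offsets [t - l], [r + l - d] and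
    [m] from hexagon vertices. The bounds on [l] follow from the strict inequalities. *)
Lemma T3_int (d : nat) (l r t m : int) :
  [&& d%:Z - l < r < d, l < t < d & 0 < m < l] ->
  in_family d [:: (0, 0); (l, 0); (d%:Z, r); (t, d%:Z); (m, m + d%:Z - l)].
Proof.
move=> H; do 2!right; left; exists (absz l), (absz (t - l)%R), (absz (r + l - d%:Z)%R), (absz m).
by do ![split; first by lia]; rewrite /pt; do ![congr cons]; congr pair; lia.
Qed.

Lemma T4_int (d : nat) (l b r t m : int) :
  [&& 0 < b < d%:Z - l, d%:Z - l < r < d, l < t < d & 0 < m < l] ->
  in_family d [:: (0, 0); (l + b, b); (d%:Z, r); (t, d%:Z); (m, m + d%:Z - l)].
Proof.
move=> H; do 3!right; left.
exists (absz l), (absz (t - l)%R), (absz (r + l - d%:Z)%R), (absz m), (absz b).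
by do ![split; first by lia]; rewrite /pt; do ![congr cons]; congr pair; lia.
Qed.

Lemma T5_int (d : nat) (l a b r t m g : int) :
  [&& 0 < a < l, 0 < g < d%:Z - l, 0 < b < d%:Z - l, d%:Z - l < r < d, l < t < d & 0 < m < l] ->
  in_family d [:: (a, 0); (l + b, b); (d%:Z, r); (t, d%:Z); (m, m + d%:Z - l); (0, g)].
Proof.
move=> H; do 4!right.
exists (absz l), (absz a), (absz (r + l - d%:Z)%R), (absz m), (absz (t - l)%R), (absz g), (absz b).
by do ![split; first by lia]; rewrite /pt; do ![congr cons]; congr pair; lia.
Qed.

Lemma square_touch (d : int) K : minp d K -> in_square d K ->
  exists x1 y2 x2 y1, touch d K x1 y2 x2 y1.
Proof.
move=> M Q.
have [|[a1 a2] [[b1 b2] [Ka [Kb]]]] := minp_width1 (v := (1, 0)) M; first by left.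
have [|[e1 e2] [[f1 f2] [Ke [Kf]]]] := minp_width1 (v := (0, 1)) M; first by right.
have /= := Q _ Ka; have /= := Q _ Kb; have /= := Q _ Ke; have /= := Q _ Kf.
rewrite /idot /= => *; exists f1, a2, e1, b2; split.
- by rewrite (_ : 0 = f2) //; lia.
- by rewrite (_ : d = a1) //; lia.
- by rewrite (_ : d = e2) //; lia.
- by rewrite (_ : 0 = b1) //; lia.
Qed.

Lemma hex_touch d l K : hex d l K -> exists b m,
  [/\ K (l + b, b), K (m, m + d%:Z - l), 0 <= b <= d%:Z - l & 0 <= m <= l].
Proof.
case=> M ld Q H.
have [|[a1 a2] [[b1 b2] [Ka [Kb]]]] := minp_width1 (v := (1, -1)) M; first by left.
have /= := H _ Ka; have /= := H _ Kb; have /= := Q _ Ka; have /= := Q _ Kb.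
rewrite /idot /= => *; exists a2, b1; split; try lia.
  by rewrite (_ : l + a2 = a1) //; lia.
by rewrite (_ : b1 + d%:Z - l = b2) //; lia.
Qed.

(** The strip puts the bottom point at abscissa at most [l] and the top point at abscissa at least
    [l], which settles [(1, 1)]; the two points on the boundary of the strip settle [(1, -1)]. *)
Lemma hex_wide (d : nat) l K S x1 y2 x2 y1 b m : hex d l K ->
  (forall s, s \in S -> K s) -> touch d (fun q => q \in S) x1 y2 x2 y1 ->
  (l + b, b) \in S -> (m, m + d%:Z - l) \in S ->
  forall v, bezout v -> wide d S v.
Proof.
case=> M ld Q H SK T Sb Sm.
have TK : touch d K x1 y2 x2 y1 by case: T => *; split; exact: SK.
apply: (square_wide _ (touch_bounds Q TK) T) => //.
  apply: (diag_wide T); case: TK => /H /= H1 _ /H /= H2 _.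
  by rewrite /diag_ok; lia.
exists (l + b, b), (m, m + d%:Z - l); split=> //; split=> //; rewrite /idot /=; lia.
Qed.

(** These vertices are bottom and top points of equal abscissa, so both diagonal conditions hold. *)
Lemma hex_opp d l K : hex d l K ->
  K (hex_vertex d l 1) -> K (hex_vertex d l 4) -> good d K.
Proof.
case=> M ld Q H; rewrite /hex_vertex /= => K1 K4.
have [x1 [y2 [x2 [y1 [T1 T2 T3 T4]]]]] := square_touch M Q.
have T : touch d K l y2 l y1 by [].
by apply: (square_good M Q T); rewrite /diag_ok /antidiag_ok lexx.
Qed.

(** With [y2 = d - l] and [x2 = l] the antidiagonal condition holds with equality, and [x1 <= l]
    gives the diagonal one. *)
Lemma hex_skip d l K : hex d l K ->
  K (hex_vertex d l 2) -> K (hex_vertex d l 4) -> good d K.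
Proof.
case=> M ld Q H; rewrite /hex_vertex /= => K1 K4.
have [x1 [y2 [x2 [y1 [T1 T2 T3 T4]]]]] := square_touch M Q.
have T : touch d K x1 (d%:Z - l) l y1 by [].
have /= := H _ T1.
by move=> ?; apply: (square_good M Q T); rewrite /diag_ok /antidiag_ok; lia.
Qed.

(** The linear part has order six; the map carries the hexagon with parameter [d - l] onto the one
    with parameter [l]. *)
Definition rot6 (d : nat) (l : int) := Amap 0 1 (-1) 1 0 (d%:Z - l).

Lemma hex_rot6 d l K : hex d l K -> hex d (d%:Z - l) (fun q => K (ap (rot6 d l) q)).
Proof.
case=> M ld Q H; split.
- exact: minp_ap.
- lia.
- by move=> q /[dup] /Q + /H; rewrite /ap /=; lia.
- by move=> q /[dup] /Q + /H; rewrite /ap /=; lia.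
Qed.

Lemma rot6_vertex d l i :
  ap (rot6 d l) (hex_vertex d (d%:Z - l) i.+1) = hex_vertex d l i.
Proof.
rewrite /hex_vertex -addn1 -modnDml.
have : (i %% 6 < 6)%N by rewrite ltn_pmod.
by case: (i %% 6)%N => [|[|[|[|[|[|n]]]]]] // _; rewrite /ap /=; congr pair; ring.
Qed.

Lemma hex_rotate n d l K : hex d l K ->
  (forall l' K', hex d l' K' ->
     (forall i, K' (hex_vertex d l' (i + n)) <-> K (hex_vertex d l i)) -> good d K') ->
  good d K.
Proof.
elim: n l K => [|n IH] l K HK G.
  by apply: (G l K) => // i; rewrite addn0.
apply: (good_ap (t := rot6 d l)) => //; apply: (IH _ _ (hex_rot6 HK)) => l' K' HK' E.
by apply: (G l' K' HK') => i; rewrite addnS -addSn E rot6_vertex.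
Qed.

Lemma hex_vertexD6 d l i : hex_vertex d l (i + 6) = hex_vertex d l i.
Proof. by rewrite /hex_vertex modnDr. Qed.

Lemma hex_rotate_to j d l K i : (i < 6)%N -> hex d l K ->
  (forall l' K', hex d l' K' ->
     (forall k, K' (hex_vertex d l' (k + j)) <-> K (hex_vertex d l (k + i))) -> good d K') ->
  good d K.
Proof.
(* [6 - i] turns bring vertex [i] to index 0 modulo 6, and [j] more to index [j]. *)
move=> i6 HK G; apply: (hex_rotate (n := (j + (6 - i))%N) HK) => l' K' HK' E.
apply: (G l' K' HK') => k; rewrite -E.
have -> : (k + i + (j + (6 - i)) = k + j + 6)%N by lia.
by rewrite hex_vertexD6.
Qed.

Lemma hex_opp_any i d l K : (i < 6)%N -> hex d l K ->
  K (hex_vertex d l i) -> K (hex_vertex d l (3 + i)) -> good d K.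
Proof.
move=> i6 HK Ki Ki3; apply: (hex_rotate_to (j := 1) i6 HK) => l' K' HK' E.
by apply: (hex_opp HK'); [apply/(E 0%N)|apply/(E 3%N)].
Qed.

Lemma hex_skip_any i d l K : (i < 6)%N -> hex d l K ->
  K (hex_vertex d l i) -> K (hex_vertex d l (2 + i)) -> good d K.
Proof.
move=> i6 HK Ki Ki2; apply: (hex_rotate_to (j := 2) i6 HK) => l' K' HK' E.
by apply: (hex_skip HK'); [apply/(E 0%N)|apply/(E 2%N)].
Qed.

(** Each of the vertices 2 to 5 is non-adjacent to vertex 0 or to vertex 1, which is an earlier
    case. Without them the other contact points are inside their sides, as in (T3). *)
Lemma hex_side_good d l K : hex d l K ->
  K (hex_vertex d l 0) -> K (hex_vertex d l 1) -> good d K.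
Proof.
move=> HK K0 K1.
have [/(hex_skip_any (i := 0) isT HK K0)//|N2] := classic (K (hex_vertex d l 2)).
have [/(hex_opp_any (i := 0) isT HK K0)//|N3] := classic (K (hex_vertex d l 3)).
have [/(hex_opp_any (i := 1) isT HK K1)//|N4] := classic (K (hex_vertex d l 4)).
have [K5|N5] := classic (K (hex_vertex d l 5)).
  exact: (hex_skip_any (i := 5) isT HK K5).
have [b [m [_ Km _ Bm]]] := hex_touch HK.
case: (HK) => M ld Q H; have [x1 [r [t [y1 T]]]] := square_touch M Q.
have B := touch_bounds Q T; case: T => _ Kr Kt _.
rewrite /hex_vertex /= in K0 K1 N2 N3 N4 N5.
have /= Hr := H _ Kr; have /= Ht := H _ Kt.
have r2 : r <> d%:Z - l by move=> E; rewrite E in Kr.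
have r3 : r <> d by move=> E; rewrite E in Kr.
have t3 : t <> d by move=> E; rewrite E in Kt.
have t4 : t <> l by move=> E; rewrite E in Kt.
have m4 : m <> l by move=> E; apply: N4; rewrite E addrAC subrr add0r in Km.
have m5 : m <> 0 by move=> E; apply: N5; rewrite E add0r in Km.
have F : in_family d [:: (0, 0); (l, 0); (d%:Z, r); (t, d%:Z); (m, m + d%:Z - l)].
  by apply: T3_int; lia.
have SK s : s \in [:: (0, 0); (l, 0); (d%:Z, r); (t, d%:Z); (m, m + d%:Z - l)] -> K s.
  by rewrite !inE => /orP [|/or4P []] /eqP ->.
apply: (good_id F SK).
(* The origin serves as bottom and as left point, and [b = 0] stands for vertex 1. *)
apply: (hex_wide (x1 := 0) (y2 := r) (x2 := t) (y1 := 0) (b := 0) (m := m) HK SK);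
  last 2 first.
- by rewrite addr0 !inE eqxx ?orbT.
- by rewrite !inE eqxx ?orbT.
by split; rewrite !inE eqxx ?orbT.
Qed.

Lemma hex_side_any i d l K : (i < 6)%N -> hex d l K ->
  K (hex_vertex d l i) -> K (hex_vertex d l (1 + i)) -> good d K.
Proof.
move=> i6 HK Ki Ki1; apply: (hex_rotate_to (j := 0) i6 HK) => l' K' HK' E.
by apply: (hex_side_good HK'); [apply/(E 0%N)|apply/(E 1%N)].
Qed.

Lemma hex_corner_good d l K : hex d l K -> K (hex_vertex d l 0) -> good d K.
Proof.
move=> HK K0.
have [/(hex_side_any (i := 0) isT HK K0)//|N1] := classic (K (hex_vertex d l 1)).
have [/(hex_skip_any (i := 0) isT HK K0)//|N2] := classic (K (hex_vertex d l 2)).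
have [/(hex_opp_any (i := 0) isT HK K0)//|N3] := classic (K (hex_vertex d l 3)).
have [K4|N4] := classic (K (hex_vertex d l 4)).
  exact: (hex_skip_any (i := 4) isT HK K4).
have [K5|N5] := classic (K (hex_vertex d l 5)).
  exact: (hex_side_any (i := 5) isT HK K5).
have [b [m [Kb Km Bb Bm]]] := hex_touch HK.
case: (HK) => M ld Q H; have [x1 [r [t [y1 T]]]] := square_touch M Q.
have B := touch_bounds Q T; case: T => _ Kr Kt _.
rewrite /hex_vertex /= in K0 N1 N2 N3 N4 N5.
have /= Hr := H _ Kr; have /= Ht := H _ Kt.
have b1 : b <> 0 by move=> E; apply: N1; rewrite E addr0 in Kb.
have b2 : b <> d%:Z - l.
  by move=> E; apply: N2; rewrite E [l + _]addrC subrK in Kb.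
have r2 : r <> d%:Z - l by move=> E; rewrite E in Kr.
have r3 : r <> d by move=> E; rewrite E in Kr.
have t3 : t <> d by move=> E; rewrite E in Kt.
have t4 : t <> l by move=> E; rewrite E in Kt.
have m4 : m <> l by move=> E; apply: N4; rewrite E addrAC subrr add0r in Km.
have m5 : m <> 0 by move=> E; apply: N5; rewrite E add0r in Km.
have F : in_family d [:: (0, 0); (l + b, b); (d%:Z, r); (t, d%:Z); (m, m + d%:Z - l)].
  by apply: T4_int; lia.
have SK s : s \in [:: (0, 0); (l + b, b); (d%:Z, r); (t, d%:Z); (m, m + d%:Z - l)] -> K s.
  by rewrite !inE => /orP [|/or4P []] /eqP ->.
apply: (good_id F SK).
apply: (hex_wide (x1 := 0) (y2 := r) (x2 := t) (y1 := 0) (b := b) (m := m) HK SK);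
  last 2 first.
- by rewrite !inE eqxx ?orbT.
- by rewrite !inE eqxx ?orbT.
by split; rewrite !inE eqxx ?orbT.
Qed.

Lemma hex_good d l K : hex d l K -> good d K.
Proof.
move=> HK.
have [[i [i6 Ki]]|NV] := classic (exists i, (i < 6)%N /\ K (hex_vertex d l i)).
  apply: (hex_rotate_to (j := 0) i6 HK) => l' K' HK' E.
  by apply: (hex_corner_good HK'); apply/(E 0%N).
have {}NV i : (i < 6)%N -> ~ K (hex_vertex d l i) by move=> i6 Ki; apply: NV; exists i.
have [b [m [Kb Km Bb Bm]]] := hex_touch HK.
case: (HK) => M ld Q H; have [a [r [t [g T]]]] := square_touch M Q.
have B := touch_bounds Q T; case: (T) => Ka Kr Kt Kg.
have N0 := NV 0%N isT; have N1 := NV 1%N isT; have N2 := NV 2%N isT.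
have N3 := NV 3%N isT; have N4 := NV 4%N isT; have N5 := NV 5%N isT.
rewrite /hex_vertex /= in N0 N1 N2 N3 N4 N5.
have /= Ha := H _ Ka; have /= Hg := H _ Kg; have /= Hr := H _ Kr; have /= Ht := H _ Kt.
have a0 : a <> 0 by move=> E; rewrite E in Ka.
have a1 : a <> l by move=> E; rewrite E in Ka.
have g0 : g <> 0 by move=> E; rewrite E in Kg.
have g5 : g <> d%:Z - l by move=> E; rewrite E in Kg.
have b1 : b <> 0 by move=> E; apply: N1; rewrite E addr0 in Kb.
have b2 : b <> d%:Z - l.
  by move=> E; apply: N2; rewrite E [l + _]addrC subrK in Kb.
have r2 : r <> d%:Z - l by move=> E; rewrite E in Kr.
have r3 : r <> d by move=> E; rewrite E in Kr.
have t3 : t <> d by move=> E; rewrite E in Kt.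
have t4 : t <> l by move=> E; rewrite E in Kt.
have m4 : m <> l by move=> E; apply: N4; rewrite E addrAC subrr add0r in Km.
have m5 : m <> 0 by move=> E; apply: N5; rewrite E add0r in Km.
have F : in_family d [:: (a, 0); (l + b, b); (d%:Z, r); (t, d%:Z); (m, m + d%:Z - l); (0, g)].
  by apply: T5_int; lia.
have SK s : s \in [:: (a, 0); (l + b, b); (d%:Z, r); (t, d%:Z); (m, m + d%:Z - l); (0, g)] -> K s.
  by rewrite !inE => /or4P [|||/or3P []] /eqP ->.
apply: (good_id F SK).
apply: (hex_wide (x1 := a) (y2 := r) (x2 := t) (y1 := g) (b := b) (m := m) HK SK);
  last 2 first.
- by rewrite !inE eqxx ?orbT.
- by rewrite !inE eqxx ?orbT.
by split; rewrite !inE eqxx ?orbT.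
Qed.

(** * Reduction to the square or the hexagon *)

(* If the antidiagonal condition fails, a point maximizing [x - y] beyond the
   four touching points can be moved one step left or up inside K, so its
   excess over a total width of d contradicts minimality. *)
Lemma antidiag_tight (d : nat) K (x1 y2 x2 y1 : int) (A B : ipt) : minp d K -> in_square d K ->
  touch d K x1 y2 x2 y1 -> ~~ antidiag_ok d x1 y2 x2 y1 ->
  K A -> K B -> (forall q, K q -> q.1 - q.2 <= A.1 - A.2) ->
  A.1 - A.2 - (B.1 - B.2) > d%:Z ->
  (A.1 - A.2 <= x1) || (A.1 - A.2 <= d%:Z - y2).
Proof.
case: A B => [a1 a2] [b1 b2] /= M Q T N KA KB Amax AB.
have [//|/norP [n1 n2]] := boolP (_ || _).
have Bd := touch_bounds Q T; case: (T) => K1 K2 K3 K4.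
have /= BA := Q _ KA.
have {}N : [/\ x1 < x2, y1 < d%:Z - x1, d%:Z - x2 < y2 & y1 < y2].
  by move: N; rewrite /antidiag_ok; split; lia.
case: N => N1 N2 N3 N4.
have conv := minp_conv M.
(* Step left if [a2 <= y1], otherwise up. The new point lies in a possibly degenerate triangle of
   [A] and two touching points; where it is not degenerate, the weights are twice the areas of the
   opposite subtriangles. *)
have [A' [KA' EA']] : exists A', K A' /\ A'.1 - A'.2 = a1 - a2 - 1.
  have [h|[h|h]] : a2 < y1 \/ a2 = y1 \/ y1 < a2 by lia.
  - exists (a1 - 1, a2); split=> /=; last lia.
    have p1 : 0 <= (a1 - 1 - x1) * y1 by apply: mulr_ge0; lia.
    have p2 : 0 <= x1 * a2 by apply: mulr_ge0; lia.
    apply: (conv (y1 * a1 - x1 * (y1 - a2) - y1) (y1 - a2) a2 _ _ _ _ _ _ _ _ _ _ KA K1 K4) => /=;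
      [lia|lia|lia|lia|ring|ring].
  - exists (a1 - 1, a2); split=> /=; last lia.
    apply: (conv (a1 - 1) 1 0 _ _ _ _ _ _ _ _ _ _ KA K4 K4) => /=; [lia|lia|lia|lia|ring|].
    by rewrite h; ring.
  exists (a1, a2 + 1); split=> /=; last lia.
  have [g|[g|g]] : a1 < x2 \/ a1 = x2 \/ x2 < a1 by lia.
  - have p1 : 0 <= x2 * (a1 - a2 - 1) by apply: mulr_ge0; lia.
    have p2 : 0 <= (x2 - a1) * y1 by apply: mulr_ge0; lia.
    have p3 : 0 <= a1 * (d%:Z - x2) by apply: mulr_ge0; lia.
    apply: (conv ((x2 - a1) * y1 + a1 * d - x2 * a2 - x2) (x2 - a1) a1
      _ _ _ _ _ _ _ _ _ _ KA K4 K3) => /=;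
      [lia|lia|lia|lia|ring|ring].
  - apply: (conv (d%:Z - a2 - 1) 1 0 _ _ _ _ _ _ _ _ _ _ KA K3 K3) => /=; [lia|lia|lia|lia| |ring].
    by rewrite g; ring.
  have p1 : 0 <= (d%:Z - x2) * (y2 - a2 - 1) by apply: mulr_ge0; lia.
  have p2 : 0 <= (d%:Z - a1) * (d%:Z - y2) by apply: mulr_ge0; lia.
  apply: (conv ((d%:Z - a1) * d + (a1 - x2) * y2 - (d%:Z - x2) * a2 - (d%:Z - x2))
    (d%:Z - a1) (a1 - x2) _ _ _ _ _ _ _ _ _ _ KA K3 K2) => /=; [lia|lia|lia|lia|ring|ring].
(* The strict excess leaves width [d] with [A'] in place of [A], yet on [S] the value of [x - y]
   stays below that at [A]. *)
pose S := [:: (x1, 0); (d%:Z, y2); (x2, d%:Z); (0, y1); A'; (b1, b2)].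
have SK s : s \in S -> K s by rewrite !inE => /or4P [|||/or3P []] /eqP ->.
have TS : touch d (fun q => q \in S) x1 y2 x2 y1 by split; rewrite !inE eqxx ?orbT.
have SW : forall v, bezout v -> wide d S v.
  apply: (square_wide _ Bd TS); first lia.
    by apply: (diag_wide TS); rewrite /diag_ok; lia.
  exists A', (b1, b2); rewrite !inE !eqxx ?orbT; split=> //; split=> //.
  by rewrite /idot /=; lia.
have [s [sS]] := minp_min M SK SW (1, -1) KA.
rewrite /idot /= => Hs; suff : s.1 - s.2 < a1 - a2 by lia.
move: sS; rewrite !inE => /or4P [|||/or3P []] /eqP -> /=; lia.
Qed.

Definition swap := Amap 0 1 1 0 0 0.

(** If the width in direction [(1, -1)] exceeded [d], [antidiag_tight] at both ends would bound the
    two extremes by touching points, and every combination of these bounds contradicts the failure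
    of [antidiag_ok]. Hence a hexagon, with [l] the maximum of [x - y]. *)
Lemma antidiag_good (d : nat) K (x1 y2 x2 y1 : int) : minp d K -> in_square d K ->
  touch d K x1 y2 x2 y1 -> ~~ antidiag_ok d x1 y2 x2 y1 -> good d K.
Proof.
move=> M Q T N; have Bd := touch_bounds Q T.
have [A [KA Amax]] := minp_max (1, -1) M.
have [B [KB Bmax]] := minp_max (-1, 1) M.
have {}Amax q : K q -> q.1 - q.2 <= A.1 - A.2 by move=> /Amax; rewrite /idot /=; lia.
have {}Bmax q : K q -> q.2 - q.1 <= B.2 - B.1 by move=> /Bmax; rewrite /idot /=; lia.
have AB : A.1 - A.2 - (B.1 - B.2) <= d.
  rewrite leNgt; apply/negP => H.
  have H1 := antidiag_tight M Q T N KA KB Amax H.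
  have Us : unim swap by [].
  have Ks q : K q -> K (ap swap (q.2, q.1)).
    rewrite [q in K q]surjective_pairing /ap /= => Kq.
    by rewrite (_ : (_, _) = (q.1, q.2)) //; congr pair; ring.
  have Qs : in_square d (fun q => K (ap swap q)) by move=> q /Q; rewrite /ap /=; lia.
  have Ts : touch d (fun q => K (ap swap q)) y1 x2 y2 x1.
    by case: T => /Ks ? /Ks ? /Ks ? /Ks ?; split.
  have Ns : ~~ antidiag_ok d y1 x2 y2 x1 by move: N; rewrite /antidiag_ok; lia.
  have Bs q : K (ap swap q) -> q.1 - q.2 <= B.2 - B.1 by move=> /Bmax; rewrite /ap /=; lia.
  have Hs : B.2 - B.1 - (A.2 - A.1) > d%:Z by lia.
  have H2 := antidiag_tight (minp_ap Us M) Qs Ts Ns (Ks _ KB) (Ks _ KA) Bs Hs.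
  by move: N H1 H2 => /=; rewrite /antidiag_ok; lia.
have [|p [q [Kp [Kq H]]]] := minp_width1 (v := (1, -1)) M; first by left.
have Ap := Amax _ Kp; have Bq := Bmax _ Kq; have Bp := Bmax _ Kp; have Aq := Amax _ Kq.
move: H; rewrite /idot /= => H.
apply: (hex_good (l := A.1 - A.2)); split=> //.
  have := Q _ KA; have [/Amax /= Hx1 _ _ _] := T; move: Hx1; rewrite subr0; lia.
by move=> r Kr; have := Amax _ Kr; have := Bmax _ Kr; lia.
Qed.

Lemma in_square_good (d : nat) K : minp d K -> in_square d K -> good d K.
Proof.
move=> M Q; have [x1 [y2 [x2 [y1 T]]]] := square_touch M Q.
have [D2|] := boolP (antidiag_ok d x1 y2 x2 y1); last exact: antidiag_good T.
have [D1|D1] := boolP (diag_ok x1 y2 x2 y1); first exact: square_good T D1 D2.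
apply: (good_ap (t := refl4 d)) => //.
apply: (antidiag_good _ _ (refl4_touch T)); first exact: minp_ap.
  by apply: square_ap => // q; rewrite /ap /=; lia.
by move: D1; rewrite /diag_ok /antidiag_ok; lia.
Qed.

Lemma minp_good (d : nat) K : minp d K ->
  (exists v, bezout v /\ forall p q, K p -> K q -> idot p v - idot q v <= d) ->
  good d K.
Proof.
move=> M [[a b] [[s [r /= E]] W]].
(* The Bezout coefficients complete the narrow direction to a basis in which it is the first
   coordinate. *)
pose t := Amap s (- b) r a 0 0.
have Ut : unim t.
  by rewrite /unim /mdet /= (_ : s * a - - b * r = 1) ?mulr1 // -E; ring.
apply: (good_ap Ut); have Mt := minp_ap Ut M.
have Xt : xwidth_le d (fun q => K (ap t q)).
  move=> p q Kp Kq; have := W _ _ Kp Kq; rewrite /idot /ap /=.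
  have F (x y : int) : (s * x + - b * y + 0) * a + (r * x + a * y + 0) * b =
      (s * a + r * b) * x by ring.
  by rewrite !F E; lia.
have [|k Wk] := second_direction _ Mt Xt; first lia.
(* This shear makes the direction [(k, 1)] the second coordinate. *)
pose u := Amap 1 0 (- k) 1 0 0.
have Uu : unim u by rewrite /unim /mdet /=; ring.
apply: (good_ap Uu); have Mu := minp_ap Uu Mt.
have Xu p q : K (ap t (ap u p)) -> K (ap t (ap u q)) -> p.1 - q.1 <= d.
  by move=> Kp Kq; have := Xt _ _ Kp Kq; rewrite /ap /=; lia.
have Yu p q : K (ap t (ap u p)) -> K (ap t (ap u q)) -> p.2 - q.2 <= d.
  by move=> Kp Kq; have := Wk _ _ Kp Kq; rewrite /idot /ap /=; lia.
have [X [KX Xmax]] := minp_max (-1, 0) Mu.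
have [Y [KY Ymax]] := minp_max (0, -1) Mu.
pose w := Amap 1 0 0 1 X.1 Y.2.
have Uw : unim w by [].
apply: (good_ap Uw); have Mw := minp_ap Uw Mu.
apply: (in_square_good Mw) => q Kq.
have := Xu _ _ Kq KX; have := Yu _ _ Kq KY; have := Xmax _ Kq; have := Ymax _ Kq.
by rewrite /idot [ap w q]/ap /=; lia.
Qed.

(** * From real polygons to lattice points *)

Lemma bezoutP v : bezout v <-> primitive v.
Proof.
split=> [[s [t E]]|H]; last first.
  by have [s [t E]] := Bezoutz v.1 v.2; exists s, t; rewrite E.
have : (gcdz v.1 v.2 %| s * v.1 + t * v.2)%Z.
  by apply: rpredD; apply: dvdz_mull; rewrite ?dvdz_gcdl ?dvdz_gcdr.
by rewrite E dvdz1 /primitive /gcdz => /eqP /= ->.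
Qed.

Section RealPolygons.
Variable R : realFieldType.
Implicit Types (P Q D : R * R -> Prop) (S : seq ipt) (p : R * R) (t : amap).

Definition apR t p : R * R :=
  ((ma t)%:~R * p.1 + (mb t)%:~R * p.2 + (me t)%:~R,
   (mc t)%:~R * p.1 + (md t)%:~R * p.2 + (mf t)%:~R).

Lemma apR_comp t u p : apR (acomp t u) p = apR t (apR u p).
Proof. by rewrite /apR /=; congr pair; ring. Qed.

Lemma apR_inv t p : unim t -> apR t (apR (ainv t) p) = p.
Proof.
move=> U; rewrite -apR_comp acomp_inv // [RHS]surjective_pairing /apR /=.
by congr pair; ring.
Qed.

Lemma inv_apR t p : unim t -> apR (ainv t) (apR t p) = p.
Proof.
move=> U; rewrite -apR_comp inv_acomp // [RHS]surjective_pairing /apR /=.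
by congr pair; ring.
Qed.

Lemma dotv_emb (q v : ipt) : dotv (emb R q) v = (idot q v)%:~R.
Proof. by rewrite /dotv /idot /=; ring. Qed.

Lemma dotv_apR t p v : dotv (apR t p) v = dotv p (tdir t v) + (idot (me t, mf t) v)%:~R.
Proof. by rewrite /dotv /apR /tdir /idot /=; ring. Qed.

Lemma conv_mem S s : s \in S -> conv S (emb R s).
Proof.
move=> sS; pose k : 'I_(size S) := Ordinal (etrans (index_mem s S) sS).
have Ek : nth (0, 0) S k = s by rewrite nth_index.
have sumk (f : 'I_(size S) -> R) : \sum_(i < size S) (i == k)%:R * f i = f k.
  rewrite (bigD1 k) //= eqxx mul1r big1 ?addr0 // => i /negPf ->; exact: mul0r.
exists (fun i => (i == k)%:R); split=> [i|]; first exact: ler0n.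
split; last by rewrite !sumk Ek.
by rewrite -[RHS](sumk (fun=> 1)); apply: eq_bigr => i _; rewrite mulr1.
Qed.

Lemma conv_sub S S' p : (forall s, s \in S' -> conv S (emb R s)) -> conv S' p -> conv S p.
Proof.
move=> H [w [w0 [w1 ->]]].
have /fin_all_exists [W HW] (i : 'I_(size S')) := H _ (mem_nth (0, 0) (ltn_ord i)).
have comb (c : 'I_(size S) -> R) : \sum_j (\sum_i w i * W i j) * c j =
    \sum_i w i * \sum_j W i j * c j.
  under eq_bigr do rewrite big_distrl /=.
  rewrite exchange_big /=; apply: eq_bigr => i _.
  by rewrite big_distrr /=; apply: eq_bigr => j _; rewrite mulrA.
exists (fun j => \sum_i w i * W i j); split=> [j|].
  by apply: sumr_ge0 => i _; apply: mulr_ge0; [exact: w0|have [] := HW i].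
split.
  transitivity (\sum_j (\sum_i w i * W i j) * 1); first by apply: eq_bigr => j _; rewrite mulr1.
  rewrite comb -[RHS]w1; apply: eq_bigr => i _; have [_ [W1 _]] := HW i.
  by under eq_bigr do rewrite mulr1; rewrite W1 mulr1.
by rewrite !comb; congr pair; apply: eq_bigr => i _; have [_ [_ [E1 E2]]] := HW i;
  rewrite ?E1 ?E2.
Qed.

Lemma conv3 (a b c : int) (p q r s : ipt) : 0 <= a -> 0 <= b -> 0 <= c -> 0 < a + b + c ->
  (a + b + c) * s.1 = a * p.1 + b * q.1 + c * r.1 ->
  (a + b + c) * s.2 = a * p.2 + b * q.2 + c * r.2 ->
  conv [:: p; q; r] (emb R s).
Proof.
move=> a0 b0 c0; set n := a + b + c => n0 E1 E2.
have nR : n%:~R != 0 :> R by rewrite intr_eq0 lt0r_neq0.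
have EnR : n%:~R = a%:~R + b%:~R + c%:~R :> R by rewrite -!rmorphD.
have {}E1 : n%:~R * s.1%:~R = a%:~R * p.1%:~R + b%:~R * q.1%:~R + c%:~R * r.1%:~R :> R.
  by rewrite -!rmorphM -!rmorphD E1.
have {}E2 : n%:~R * s.2%:~R = a%:~R * p.2%:~R + b%:~R * q.2%:~R + c%:~R * r.2%:~R :> R.
  by rewrite -!rmorphM -!rmorphD E2.
have n0R : 0 <= n%:~R^-1 :> R by rewrite invr_ge0 ler0z ltW.
exists (fun i => nth 0 [:: a%:~R; b%:~R; c%:~R] i / n%:~R) => /=; split=> [[[|[|[|i]]] ?] //=|];
  rewrite ?mulr_ge0 ?ler0z //.
rewrite !big_ord_recl !big_ord0 /= !addr0; split; first by rewrite -!mulrDl addrA -EnR divff.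
by congr pair; apply: (mulfI nR); rewrite ?E1 ?E2; field.
Qed.

Lemma conv_dot_le S p v : conv S p -> exists s, s \in S /\ dotv p v <= (idot s v)%:~R.
Proof.
case=> w [w0 [w1 ->]]; have [s0 s0S] : exists s, s \in S.
  case: S w w0 w1 => [|s S] w _; last by exists s; rewrite mem_head.
  by rewrite big_ord0 => /esym /eqP; rewrite oner_eq0.
have [m [mS Hm]] := seq_max (idot^~ v) s0S.
exists m; split=> //; rewrite /dotv /= !big_distrl -big_split /=.
have -> : (idot m v)%:~R = \sum_i w i * (idot m v)%:~R by rewrite -big_distrl /= w1 mul1r.
apply: ler_sum => i _.
rewrite -!mulrA -mulrDr; apply: ler_wpM2l; first exact: w0.
by rewrite -!intrM -intrD ler_int; apply: Hm; rewrite mem_nth.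
Qed.

Lemma conv_map S t p : conv S p -> conv [seq ap t s | s <- S] (apR t p).
Proof.
case=> w [w0 [w1 ->]].
(* The index types differ only through [size_map], so a cast carries the weights over. *)
pose c (i : 'I_(size [seq ap t s | s <- S])) := cast_ord (size_map (ap t) S) i.
have cK (F : 'I_(size S) -> R) : \sum_i F (c i) = \sum_i F i.
  rewrite (reindex_onto c (cast_ord (esym (size_map (ap t) S)))) /=; last first.
    by move=> i _; apply: val_inj.
  by apply: eq_bigl => i; apply/esym/eqP/val_inj.
have cE (i : 'I_(size [seq ap t s | s <- S])) :
    nth (0, 0) [seq ap t s | s <- S] i = ap t (nth (0, 0) S (c i)).
  by rewrite (nth_map (0, 0)) //; exact: (ltn_ord (c i)).
exists (fun i => w (c i)); split=> [i|]; first exact: w0.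
split; first by rewrite (cK w).
have sE (f : ipt -> R) : \sum_i w (c i) * f (nth (0, 0) [seq ap t s | s <- S] i) =
    \sum_i w i * f (ap t (nth (0, 0) S i)).
  rewrite -(cK (fun i => w i * f (ap t (nth (0, 0) S i)))).
  by apply: eq_bigr => i _; rewrite cE.
have /= -> := sE (fun s => s.1%:~R); have /= -> := sE (fun s => s.2%:~R).
have lin (a b e : R) (x y : 'I_(size S) -> R) :
    a * (\sum_i w i * x i) + b * (\sum_i w i * y i) + e = \sum_i w i * (a * x i + b * y i + e).
  rewrite -[e in LHS]mulr1 -w1 !big_distrr /= -!big_split /=.
  by apply: eq_bigr => i _; ring.
by rewrite /apR /= !lin; congr pair; apply: eq_bigr => i _; rewrite /ap /=; congr (_ * _); ring.
Qed.

Lemma has_lw_uniq P w w' : has_lw P w -> has_lw P w' -> w = w'.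
Proof.
move=> [[v [Pv Hv]] H] [[v' [Pv' Hv']] H'].
by apply/le_anti; rewrite (H _ _ Pv' Hv') (H' _ _ Pv Hv).
Qed.

(** Extremes over the hull are attained at points of [S], so every width is an integer. *)
Lemma conv_lw_dir S v : S <> [::] -> exists s s', [/\ s \in S, s' \in S &
  lw_dir (conv (R := R) S) v (idot s v - idot s' v)%:~R].
Proof.
move=> S0; have [s0 s0S] : exists s, s \in S.
  by case: S S0 => // s S _; exists s; rewrite mem_head.
have [m [mS Hm]] := seq_max (idot^~ v) s0S.
have [n [nS Hn]] := seq_max (fun s => - idot s v) s0S.
exists m, n; split=> //; exists (idot m v)%:~R, (idot n v)%:~R.
split; first by exists (emb R m); split; [exact: conv_mem|exact: dotv_emb].
split.
  by move=> p /(conv_dot_le v) [s [/Hm sS]] /le_trans; apply; rewrite ler_int.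
split; first by exists (emb R n); split; [exact: conv_mem|exact: dotv_emb].
split; last by rewrite rmorphB.
move=> p /(conv_dot_le (- v.1, - v.2)) [s [/Hn sS]].
have -> : dotv p (- v.1, - v.2) = - dotv p v by rewrite /dotv /=; ring.
have -> : idot s (- v.1, - v.2) = - idot s v by rewrite /idot /=; ring.
rewrite rmorphN lerN2; apply: le_trans; rewrite ler_int; move: sS; lia.
Qed.


(** * Invariance of width and minimality under unimodular maps *)

Lemma tdir_comp t u v : tdir (acomp t u) v = tdir u (tdir t v).
Proof. by rewrite /tdir /=; congr pair; ring. Qed.

Lemma tdir_id v : tdir aid v = v.
Proof. by rewrite [RHS]surjective_pairing /tdir /=; congr pair; ring. Qed.

Lemma lw_dir_ap P Q t v w : unim t -> (forall p, Q p <-> P (apR t p)) ->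
  lw_dir Q (tdir t v) w -> lw_dir P v w.
Proof.
move=> U PQ [a [b [[x [Qx Ex]] [Ha [[y [Qy Ey]] [Hb ->]]]]]].
pose e : R := (idot (me t, mf t) v)%:~R.
have inv p : P p -> exists q, Q q /\ dotv p v = dotv q (tdir t v) + e.
  move=> Pp; exists (apR (ainv t) p); rewrite PQ apR_inv //; split=> //.
  by rewrite -dotv_apR apR_inv.
exists (a + e), (b + e); split.
  by exists (apR t x); split; [exact/PQ|rewrite dotv_apR Ex].
split; first by move=> p /inv [q [/Ha Hq ->]]; rewrite lerD2r.
split.
  by exists (apR t y); split; [exact/PQ|rewrite dotv_apR Ey].
split; first by move=> p /inv [q [/Hb Hq ->]]; rewrite lerD2r.
by ring.
Qed.

Lemma has_lw_ap P Q t w : unim t -> (forall p, Q p <-> P (apR t p)) ->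
  has_lw Q w -> has_lw P w.
Proof.
move=> U PQ [[u [/bezoutP Pu Hu]] H].
have U' := unim_inv U.
have QP p : P p <-> Q (apR (ainv t) p) by rewrite PQ apR_inv.
split.
  exists (tdir (ainv t) u); split; first exact/bezoutP/tdir_bezout.
  by apply: (lw_dir_ap U PQ); rewrite -tdir_comp inv_acomp // tdir_id.
move=> v w' /bezoutP Pv Hv; apply: (H (tdir t v)); first exact/bezoutP/tdir_bezout.
by apply: (lw_dir_ap U' QP); rewrite -tdir_comp acomp_inv // tdir_id.
Qed.

Lemma lattice_ap P Q t : unim t -> (forall p, Q p <-> P (apR t p)) ->
  lattice_polygon P -> lattice_polygon Q.
Proof.
move=> U PQ [S [S0 PS]]; exists [seq ap (ainv t) s | s <- S]; split; first by case: S S0 {PS}.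
move=> p; rewrite PQ PS; split=> [/(conv_map (ainv t))|/(conv_map t)]; first by rewrite inv_apR.
by rewrite -map_comp map_id_in // => s _ /=; rewrite ap_inv.
Qed.

Lemma minimal_ap P Q t : unim t -> (forall p, Q p <-> P (apR t p)) ->
  minimal_polygon P -> minimal_polygon Q.
Proof.
move=> U PQ [LP MP]; split; first exact: (lattice_ap U PQ).
move=> Q' LQ' [Q'Q [p [Qp NQ'p]]]; have U' := unim_inv U.
have QP r : P r <-> Q (apR (ainv t) r) by rewrite PQ apR_inv.
pose P' r := Q' (apR (ainv t) r).
have QP' r : P' r <-> Q' (apR (ainv t) r) by [].
have PQ' r : Q' r <-> P' (apR t r) by rewrite /P' inv_apR.
have [||w [w' [Hw [Hw' ww']]]] := MP P'; first exact: (lattice_ap U' QP').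
  split=> [r /Q'Q /QP //|]; exists (apR t p); split; first exact/PQ.
  by rewrite -PQ'.
exists w, w'; split; first exact: (has_lw_ap U' QP').
by split=> //; exact: (has_lw_ap U' QP).
Qed.

(** The hull of [S] lies in [D] and its lattice width is at least [d], so minimality forbids a
    proper inclusion. *)
Lemma minimal_full D d S : minimal_polygon D -> has_lw D d%:~R ->
  (forall s, s \in S -> D (emb R s)) -> (forall v, bezout v -> wide d S v) ->
  forall p, D p <-> conv S p.
Proof.
move=> [[S0 [S0n DS0]] M] HD SD W.
have SubD p : conv S p -> D p by move=> Sp; apply/DS0; apply: conv_sub Sp => s /SD /DS0.
have Sn : S <> [::].
  by move=> S_0; have [|p [q []]] := W (1, 0); [exists 1, 0|rewrite S_0].
move=> p; split=> [Dp|]; last exact: SubD.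
apply: NNPP => Np; have [||w [w' [Hw [Hw' ww']]]] := M (conv S).
- by exists S.
- by split=> //; exists p.
move: ww'; rewrite (has_lw_uniq Hw' HD).
have [[v [/bezoutP Bv Hv]] _] := Hw; have [x [y [xS [yS xy]]]] := W v Bv.
have [s [s' [sS s'S Hs]]] := conv_lw_dir v Sn.
have [a [b [_ [Ha [_ [Hb Ew]]]]]] := Hv.
have := Ha _ (conv_mem xS); have := Hb _ (conv_mem yS); rewrite !dotv_emb => Hy Hx.
move: xy; rewrite -(ler_int R) rmorphB => xy; rewrite Ew ltNge => /negP; apply.
by apply: (le_trans xy); apply: lerB.
Qed.

Lemma minimal_minp D (d : int) : minimal_polygon D -> has_lw D d%:~R ->
  minp d (fun q => D (emb R q)).
Proof.
move=> M HD; have [[S [Sn DS]] _] := M; split.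
- move=> a b c p q r s a0 b0 c0 n0 E1 E2 Dp Dq Dr; apply/DS.
  apply: conv_sub (conv3 a0 b0 c0 n0 E1 E2) => x.
  by rewrite !inE => /or3P [] /eqP ->; apply/DS.
- exists S; split=> [s /conv_mem sS|v q /DS /(conv_dot_le v) [s [sS]]]; first exact/DS.
  by rewrite dotv_emb ler_int; exists s.
- by case: S Sn DS => // s S _ DS; exists s; apply/DS/conv_mem/mem_head.
- move=> v /bezoutP Pv; have [s [s' [sS s'S Hs]]] := conv_lw_dir v Sn.
  exists s, s'; split; [exact/DS/conv_mem|split; first exact/DS/conv_mem].
  have [_ Hmin] := HD; rewrite -(ler_int R); apply: Hmin Pv _.
  apply: (lw_dir_ap (t := aid) (Q := conv S)) => //; last by rewrite tdir_id.
  by move=> p; rewrite DS /apR /= mul1r !mul0r mul1r !addr0 add0r -surjective_pairing.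
- move=> S' S'D W v q /(minimal_full M HD S'D W) /(conv_dot_le v) [s [sS]].
  by rewrite dotv_emb ler_int; exists s.
Qed.

Lemma minimal_narrow D (d : int) : has_lw D d%:~R ->
  exists v, bezout v /\ forall x y, D (emb R x) -> D (emb R y) -> idot x v - idot y v <= d.
Proof.
move=> [[v [/bezoutP Bv [a [b [_ [Ha [_ [Hb E]]]]]]]] _]; exists v; split=> // x y /Ha + /Hb.
by rewrite !dotv_emb -(ler_int R) E rmorphB => *; apply: lerB.
Qed.

Lemma unimod_equiv_ap P Q t : unim t -> (forall p, Q p <-> P (apR t p)) -> unimod_equiv P Q.
Proof.
(* The matrix must carry [P] to [Q], while [t] goes from [Q] to [P]. *)
move=> U PQ; pose u := ainv t.
pose A : 'M[int]_2 := \matrix_(i, j)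
  if i == 0 then if j == 0 then ma u else mb u else if j == 0 then mc u else md u.
have affE p : aff A (me u, mf u) p = apR u p by rewrite /aff !mxE.
exists A, (me u, mf u); split.
  rewrite (_ : \det _ = mdet u); last first.
    rewrite /A; clearbody u; rewrite (expand_det_row _ 0) !big_ord_recl big_ord0.
    rewrite /cofactor !det_mx11 !mxE /=.
    by rewrite /mdet /bump /= !add0n expr0 expr1; ring.
  by apply/eqP; rewrite -sqr_norm_eq1 expr2; apply/eqP; apply: unim_inv.
move=> q; rewrite PQ; split=> [Pq|[p [Pp ->]]]; last by rewrite affE apR_inv.
by exists (apR t q); rewrite affE inv_apR.
Qed.
End RealPolygons.

Theorem theorem2p4 (R : realFieldType) (D : R * R -> Prop) (d : nat) :
  minimal_polygon D -> has_lw D d%:R ->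
  exists S : seq ipt,
    (family_T1 d S \/ family_T2 d S \/ family_T3 d S \/
     family_T4 d S \/ family_T5 d S) /\
    minimal_polygon (conv (R:=R) S) /\ unimod_equiv D (conv (R:=R) S).
Proof.
move=> M HD; have {}HD : has_lw D d%:~R by [].
have [t [S [U [F [SD W]]]]] := minp_good (minimal_minp M HD) (minimal_narrow HD).
(* The image of the family member under [t] lies in [D] with full width, so it spans [D]. *)
have full : forall p, D p <-> conv [seq ap t s | s <- S] p.
  apply: (minimal_full M HD) => [s /mapP [s' /SD ? ->] //|]; exact: wide_map.
have PQ p : conv S p <-> D (apR t p).
  rewrite full; split=> [/(conv_map t) //|/(conv_map (ainv t))].
  by rewrite inv_apR // -map_comp map_id_in // => s _ /=; rewrite inv_ap.
exists S; split=> //; split; first exact: (minimal_ap U PQ).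
exact: (unimod_equiv_ap U PQ).
Qed.
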